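(* Let $A\in\mathbb{R}^{n\times m}$ have full column rank, let $s$ be an integer with $m\le s<n$, and consider the 0/1 D-optimality problem $$\max\big\{\operatorname{ldet}(A^\top\operatorname{Diag}(x)A) : \mathbf{e}^\top x=s,\ x\in\{0,1\}^n\big\}.\qquad(\text{D-Opt(0/1)})$$ Let $A=U\Sigma V^\top$ be the (compact) real singular-value decomposition of $A$, with $U\in\mathbb{R}^{n\times m}$, $\Sigma\in\mathbb{R}^{m\times m}$ diagonal, $V\in\mathbb{R}^{m\times m}$, $U^\top U=V^\top V=VV^\top=I_m$, and let $W\in\mathbb{R}^{n\times(n-m)}$ satisfy $I_n-UU^\top=WW^\top$. Then the problem $$2\sum_{i=1}^m\log(\Sigma_{ii})+\max\Big\{\Gamma_{n-s}\big(W^\top\operatorname{Diag}(y)W\big) : \mathbf{e}^\top y=n-s,\ 0\le y\le\mathbf{e}\Big\}$$ is an exact convex relaxation of (D-Opt(0/1)). That is: (i) for every feasible solution $\hat x$ of (D-Opt(0/1)) with objective value $\hat z$, the vector $\hat y:=\mathbf{e}-\hat x$ is feasible for this problem with the same objective value $\hat z$ (the constant $2\sum_{i}\log\Sigma_{ii}$ included); and (ii) this problem is convex, i.e., it maximizes a concave function of $y$ over a convex set.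
   Context: $\mathbf{e}$ is the all-ones vector; $\operatorname{Diag}(x)$ is the diagonal matrix with diagonal $x$; $\operatorname{ldet}$ is the logarithm of the determinant, with $\log(0)=-\infty$. The $\Gamma$-function: for $\lambda\in\mathbb{R}_+^k$ with $\lambda_1\ge\dots\ge\lambda_k$ and an integer $t$ with $0<t\le k$, there is a unique integer $\iota$ with $0\le\iota<t$ such that $\lambda_\iota>\frac{1}{t-\iota}\sum_{\ell=\iota+1}^k\lambda_\ell\ge\lambda_{\iota+1}$, with the convention $\lambda_0=+\infty$. Define $$\phi_t(\lambda):=\sum_{\ell=1}^{\iota}\log(\lambda_\ell)+(t-\iota)\log\Big(\tfrac{1}{t-\iota}\sum_{\ell=\iota+1}^k\lambda_\ell\Big),$$ with $\log(0)=-\infty$. For a symmetric positive-semidefinite $k\times k$ matrix $X$, $\Gamma_t(X):=\phi_t(\lambda(X))$, where $\lambda(X)$ is the vector of eigenvalues of $X$ in nonincreasing order. *)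

(* Defs.v *)
From mathcomp Require Export all_boot all_order all_algebra.
From mathcomp Require Export all_classical all_reals all_analysis.
Set Implicit Arguments.
Unset Strict Implicit.
Unset Printing Implicit Defensive.
Import Order.TTheory GRing.Theory Num.Theory.
Local Open Scope classical_set_scope.
Local Open Scope ring_scope.

Section Definitions.
Context {R : realType}.

Definition ones n : 'cV[R]_n := const_mx 1.

Definition Diag n (x : 'cV[R]_n) : 'M[R]_n := diag_mx x^T.

Definition psdmx k (X : 'M[R]_k) : Prop :=
  X^T = X /\ forall v : 'cV[R]_k, 0 <= (v^T *m X *m v) 0 0.

(* Library conventions: lne x%:E = (ln x)%:E for 0 < x and lne 0 = -oo. *)
Definition ldet k (X : 'M[R]_k) : \bar R := lne (\det X)%:E.

(* l lists the eigenvalues of X, with multiplicity, in nonincreasing order. *)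
Definition is_eigvals k (X : 'M[R]_k) (l : k.-tuple R) : Prop :=
  sorted >=%R l /\ char_poly X = \prod_(a <- l) ('X - a%:P).

(* There is at most one such list (is_eigvals_unique below). It exists when X
   is symmetric; the default value only occurs for some nonsymmetric X. *)
Definition eigvals k (X : 'M[R]_k) : k.-tuple R :=
  xget [tuple of nseq k 0] [set l | is_eigvals X l].

(* Vectors are indexed from 0: the entry lambda_l of the 1-based convention is
   lam`_l.-1. Thus tail_mean lam t i = (sum_(l = i+1)^k lambda_l) / (t - i). *)
Definition tail_mean k (lam : k.-tuple R) (t i : nat) : R :=
  (t - i)%:R^-1 * \sum_(i <= l < k) lam`_l.

(* lambda_i > tail_mean lam t i >= lambda_(i+1), where lambda_0 = +oo. *)
Definition is_iota k (lam : k.-tuple R) (t i : nat) : Prop :=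
  [/\ (i < t)%N,
      (0 < i)%N -> tail_mean lam t i < lam`_i.-1 &
      lam`_i <= tail_mean lam t i].

(* Well defined for lam nonincreasing, lam >= 0, 0 < t <= k (is_iota_exists and
   is_iota_unique below). *)
Definition iota_idx k (lam : k.-tuple R) (t : nat) : nat :=
  xget 0%N [set i | is_iota lam t i].

Definition phi k (t : nat) (lam : k.-tuple R) : \bar R :=
  let i := iota_idx lam t in
  (\sum_(l < i) lne (lam`_l)%:E +
   ((t - i)%:R)%:E * lne (tail_mean lam t i)%:E)%E.

(* Meaningful for 0 < t <= k and X positive semidefinite. *)
Definition Gamma k (t : nat) (X : 'M[R]_k) : \bar R := phi t (eigvals X).

Definition dopt_feasible n (s : nat) : set 'cV[R]_n :=
  [set x | ((ones n)^T *m x) 0 0 = s%:R /\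
           forall i, x i 0 = 0 \/ x i 0 = 1].

Definition dopt_objective n m (A : 'M[R]_(n, m)) (x : 'cV[R]_n) : \bar R :=
  ldet (A^T *m Diag x *m A).

Definition compact_svd n m (A U : 'M[R]_(n, m)) (Sg V : 'M[R]_m) : Prop :=
  [/\ A = U *m Sg *m V^T,
      U^T *m U = 1%:M,
      V^T *m V = 1%:M /\ V *m V^T = 1%:M,
      is_diag_mx Sg &
      forall i, 0 <= Sg i i].

Definition relax_feasible n (s : nat) : set 'cV[R]_n :=
  [set y | ((ones n)^T *m y) 0 0 = (n - s)%:R /\
           forall i, 0 <= y i 0 <= 1].

Definition relax_domain n k (W : 'M[R]_(n, k)) : set 'cV[R]_n :=
  [set y | psdmx (W^T *m Diag y *m W)].

Definition relax_objective n m k (s : nat) (Sg : 'M[R]_m) (W : 'M[R]_(n, k))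
    (y : 'cV[R]_n) : \bar R :=
  (2%:E * \sum_(i < m) lne (Sg i i)%:E +
   Gamma (n - s) (W^T *m Diag y *m W))%E.

(* Concavity of f : D -> [-oo, +oo[. As f never takes the value +oo on D, the
   combination below contains no indeterminate sum; by convention 0 * -oo = 0. *)
Definition concave_on (E : lmodType R) (D : set E) (f : E -> \bar R) : Prop :=
  [/\ @convex_set R E D,
      forall x, D x -> (f x < +oo)%E &
      forall (t : R) (x y : E), 0 <= t <= 1 -> D x -> D y ->
        (t%:E * f x + (1 - t)%:E * f y <= f (t *: x + (1 - t) *: y)%R)%E].

End Definitions.

Section WellDefined.
Context {R : realType}.

Lemma is_eigvals_unique k (X : 'M[R]_k) (l1 l2 : k.-tuple R) :
  is_eigvals X l1 -> is_eigvals X l2 -> l1 = l2.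
Proof.
move=> [s1 e1] [s2 e2]; apply/val_inj/(@sorted_eq _ >=%R) => //=.
- by move=> y x z xy yz; exact: le_trans yz xy.
- by move=> x y; rewrite andbC; exact: le_anti.
by apply: prod_XsubC_eq; rewrite -e1 -e2.
Qed.

Section Iota.
Variables (k t : nat) (lam : k.-tuple R).
Hypotheses (lam_sorted : sorted >=%R lam) (t_gt0 : (0 < t)%N)
  (t_le_k : (t <= k)%N).

Let below i := lam`_i <= tail_mean lam t i.

Let lam_le i : (i.+1 < t)%N -> lam`_i.+1 <= lam`_i.
Proof.
move=> it; have ik : (i.+1 < size lam)%N.
  by rewrite size_tuple (leq_trans it).
by move: lam_sorted => /(sortedP 0) /(_ _ ik).
Qed.

Let belowE i : (i < t)%N ->
  below i = (lam`_i *+ (t - i) <= \sum_(i <= l < k) lam`_l).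
Proof.
move=> it; rewrite /below /tail_mean mulrC ler_pdivlMr ?mulr_natr//.
by rewrite ltr0n subn_gt0.
Qed.

Let below_succ i : (i.+1 < t)%N ->
  below i = (lam`_i <= tail_mean lam t i.+1).
Proof.
move=> it; rewrite belowE ?(ltnW it)// big_ltn; last first.
  by rewrite (leq_trans (ltnW it)).
rewrite -(subnSK (ltnW it)) mulrS lerD2l.
rewrite /tail_mean [X in _ = (_ <= X)]mulrC ler_pdivlMr ?mulr_natr//.
by rewrite ltr0n subn_gt0.
Qed.

Let is_iotaE i : is_iota lam t i <->
  [/\ (i < t)%N, below i & forall j, (j < i)%N -> ~~ below j].
Proof.
split=> [[it gt le]|[it le gt]]; split=> //; last first.
  case: i it le gt => // i it le /(_ i (ltnSn i)) + _.
  by rewrite below_succ// -ltNge.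
move=> j ji; apply/negP => bj; case: i it gt le ji => // i it /(_ isT) + _ ji.
rewrite ltNge/= -below_succ// => /negP; apply.
elim: i it ji => [|i IH] it.
  by rewrite ltnS leqn0 => /eqP <-.
rewrite ltnS leq_eqVlt => /predU1P[<-//|/(IH (ltnW it))].
by rewrite below_succ ?(ltnW it)//; apply: le_trans; exact/lam_le/ltnW.
Qed.

Lemma is_iota_exists :
  (forall i, (i < k)%N -> 0 <= lam`_i) -> exists i, is_iota lam t i.
Proof.
move=> lam_ge0; have ex : exists i, (i < t)%N && below i.
  exists t.-1; rewrite prednK// leqnn belowE ?prednK//.
  have -> : (t - t.-1 = 1)%N by rewrite -subn1 subKn.
  rewrite mulr1n big_ltn ?prednK// lerDl big_nat_cond sumr_ge0// => l.
  by case/andP => /andP[_ lk] _; exact: lam_ge0.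
case: (ex_minnP ex) => i /andP[it bi] imin.
exists i; apply/is_iotaE; split=> // j ji; apply/negP => bj.
have /imin : (j < t)%N && below j by rewrite bj (ltn_trans ji).
by rewrite leqNgt ji.
Qed.

Lemma is_iota_unique i j : is_iota lam t i -> is_iota lam t j -> i = j.
Proof.
move=> /is_iotaE[_ bi mi] /is_iotaE[_ bj mj].
case: (ltngtP i j) => // [/mj|/mi]; first by rewrite bi.
by rewrite bj.
Qed.

End Iota.
End WellDefined.

(* Main.v *)
(* Gamma_t is an infimum of affine functions. By ln x <= x - 1, phi_t(lambda)
   is the infimum, over positive nondecreasing weights theta, of
     sum_l theta_l lambda_l - sum_(l <= t) (ln theta_l + 1).
   In an orthonormal eigenbasis of Z, the diagonal of X is the image of
   lambda(X) under a doubly stochastic matrix, so by rearrangement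
   sum_i theta_i X_ii >= sum_l theta_l lambda_l(X), with equality at X = Z; the
   left side is linear in X, hence Gamma_t is concave.
   For exactness, let D = Diag(e - x). As D is idempotent, Sylvester's
   determinant identity relates the characteristic polynomials P of W^T D W and
   Q of U^T Diag(x) U by
     (z - 1)^m P(z) = z^(s - m) (z - 1)^(n - s) Q(z).
   Thus W^T D W has at least s - m zero eigenvalues, Gamma_(n-s) reduces to the
   log of the product of the n - s others, and this product is Q(0) up to
   sign. *)
Require Import Defs.
From mathcomp Require Import all_fingroup spectral complex ring lra zify.
Import Order.TTheory GRing.Theory Num.Theory.
Set Implicit Arguments.
Unset Strict Implicit.
Unset Printing Implicit Defensive.
Local Open Scope classical_set_scope.
Local Open Scope ring_scope.

(** * Orthogonal diagonalization of real symmetric matrices *)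

Section Spectral.
Context {F : rcfType}.

Lemma dot_ge0 n (v : 'rV[F]_n) : 0 <= (v *m v^T) 0 0.
Proof. by rewrite mxE sumr_ge0// => i _; rewrite mxE -expr2 sqr_ge0. Qed.

Lemma dot_eq0 n (v : 'rV[F]_n) : ((v *m v^T) 0 0 == 0) = (v == 0).
Proof.
apply/eqP/eqP => [|->]; last by rewrite mul0mx mxE.
rewrite mxE => /psumr_eq0P v0; apply/rowP => i; rewrite mxE; apply/eqP.
rewrite -sqrf_eq0 expr2; apply/eqP; have := v0 _ i isT.
by rewrite mxE; apply => j _; rewrite mxE -expr2 sqr_ge0.
Qed.

(** Over the complex extension [X] becomes Hermitian, so its spectral values are real. Such a value
    is an eigenvalue of [X] itself by [eigenvalue_map], and the eigenvector found over [F] is then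
    normalized. *)
Lemma symmx_unit_eigenvector n (X : 'M[F]_n.+1) : X^T = X ->
  exists a, exists2 v : 'rV[F]_n.+1, v *m v^T = 1%:M & v *m X = a *: v.
Proof.
move=> Xsym; pose c := real_complex F; pose Z := map_mx c X.
have Zherm : Z \is hermsymmx.
  apply: realsym_hermsym.
    by apply/is_hermitianmxP; rewrite expr0 scale1r map_mx_id//= map_trmx Xsym.
  apply/mxOverP => i j; rewrite mxE; apply/complex_realP.
  by exists (X i j).
have /mxOverP/(_ 0 0)/complex_realP[a da] := hermitian_spectral_diag_real Zherm.
have : eigenvalue Z (c a).
  apply/eigenvalueP; exists (row 0 (spectralmx Z)).
    have /hermitian_normalmx/orthomx_spectralP ZE := Zherm.
    rewrite -row_mul [X in _ *m X]ZE -mulmxA mulKVmx ?spectral_unit//.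
    by rewrite mul_diag_mx; apply/rowP => j; rewrite !mxE da.
  apply/eqP => r0; have /row_freeP[B /(congr1 (row 0))] :
      row_free (spectralmx Z) by rewrite row_free_unit spectral_unit.
  rewrite row_mul r0 mul0mx => /matrixP/(_ 0 0)/eqP.
  by rewrite !mxE eqxx eq_sym oner_eq0.
rewrite eigenvalue_map => /eigenvalueP[v vX v0].
have vv : 0 < (v *m v^T) 0 0 by rewrite lt_def dot_eq0 v0 dot_ge0.
exists a, ((Num.sqrt ((v *m v^T) 0 0))^-1 *: v); last first.
  by rewrite -scalemxAl vX !scalerA mulrC.
rewrite linearZ/= -scalemxAr -scalemxAl scalerA -expr2 exprVn sqr_sqrtr ?ltW//.
by rewrite [v *m _]mx11_scalar scale_scalar_mx mxE eqxx mulr1n mulVf ?gt_eqF.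
Qed.

(* The Householder reflection exchanging v and the first basis vector. *)
Lemma orthomx_with_row0 n (v : 'rV[F]_n.+1) : v *m v^T = 1%:M ->
  exists2 H : 'M[F]_n.+1, H *m H^T = 1%:M & row 0 H = v.
Proof.
move=> v1; have [->|ve] := eqVneq v (delta_mx 0 0).
  by exists 1%:M; [rewrite trmx1 mulmx1|rewrite row1].
pose e : 'rV[F]_n.+1 := delta_mx 0 0; pose w := e - v; pose q := (w *m w^T) 0 0.
have q0 : q != 0 by rewrite dot_eq0 subr_eq0 eq_sym.
have wwT : w *m w^T = q%:M by rewrite [LHS]mx11_scalar.
have e1 : e *m e^T = 1%:M by rewrite trmx_delta mul_delta_mx [RHS]mx11_scalar;
  apply/matrixP => i j; rewrite !ord1 !mxE.
(* As [e] and [v] are unit vectors, |e - v|^2 = 2 - 2 e.v = 2 e.w. Hence the reflection moves [e] by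
   exactly [w], onto [v]. *)
have ewT : e *m w^T = (q / 2)%:M.
  rewrite [LHS]mx11_scalar; congr (_%:M).
  have -> : q = 2 * (e *m w^T) 0 0; last first.
    by rewrite mulrAC mulfV ?mul1r ?pnatr_eq0.
  have ev : v *m e^T = e *m v^T.
    by rewrite [RHS]mx11_scalar -tr_scalar_mx -mx11_scalar trmx_mul trmxK.
  rewrite /q /w linearB/= mulmxBl !mulmxBr v1 e1 ev [e *m v^T]mx11_scalar.
  by rewrite !mxE eqxx; ring.
pose P := w^T *m w; pose H : 'M[F]_n.+1 := 1%:M - (2 / q) *: P.
have PT : P^T = P by rewrite trmx_mul trmxK.
have PP : P *m P = q *: P.
  by rewrite mulmxA -[P *m w^T]mulmxA wwT mul_mx_scalar -scalemxAl.
exists H.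
  have -> : H^T = H by rewrite linearB/= linearZ/= trmx1 PT.
  rewrite mulmxBl mul1mx mulmxBr mulmx1 -scalemxAl -scalemxAr PP !scalerA.
  rewrite -mulrA divfK// mulr_natr -scalerMnl mulr2n.
  by rewrite opprB addrK subrK.
rewrite rowE mulmxBr mulmx1 -scalemxAr mulmxA ewT mul_scalar_mx scalerA.
by rewrite mulrA divfK// divff ?scale1r ?pnatr_eq0// subKr.
Qed.

(** Deflation: in an orthonormal basis starting with a unit eigenvector, the first row is zero off
    the diagonal, and by symmetry so is the first column. The induction hypothesis diagonalizes the
    remaining block. *)
Theorem symmx_spectral n (X : 'M[F]_n) : X^T = X ->
  exists2 Q : 'M[F]_n, Q *m Q^T = 1%:M &
    exists d : 'rV[F]_n, Q *m X *m Q^T = diag_mx d.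
Proof.
elim: n X => [|n IH] X Xsym.
  by exists 1%:M; [|exists 0]; apply/matrixP => -[].
have [a [v v1 vX]] := symmx_unit_eigenvector Xsym.
have [H H1 Hv] := orthomx_with_row0 v1.
pose Y : 'M[F]_(1 + n) := H *m X *m H^T.
have YT : Y^T = Y by rewrite /Y !trmx_mul trmxK Xsym mulmxA.
have rowY : row 0 Y = a *: delta_mx 0 0.
  by rewrite /Y !row_mul Hv vX -Hv -scalemxAl -row_mul H1 row1.
pose o : 'I_(1 + n) := lshift n 0.
have Y0 j : Y o j = a *+ (j == o).
  have -> : o = 0 by exact: val_inj.
  by have /matrixP/(_ 0 j) := rowY; rewrite ![row _ _ _ _]mxE => ->;
    rewrite !mxE eqxx/= mulr_natr.
have YE : Y = block_mx a%:M 0 0 (drsubmx Y).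
  move: (Y) YT Y0 => Z ZT Z0.
  rewrite -[LHS]submxK; congr block_mx; apply/matrixP => i j; rewrite !mxE.
  - by rewrite !ord1 Z0 eqxx.
  - by rewrite !ord1 Z0 eq_rlshift.
  - by rewrite -ZT mxE !ord1 Z0 eq_rlshift.
have [Q Q1 [d Qd]] : exists2 Q : 'M[F]_n, Q *m Q^T = 1%:M &
    exists d : 'rV[F]_n, Q *m drsubmx Y *m Q^T = diag_mx d.
  by apply: IH; rewrite trmx_drsub YT.
pose B : 'M[F]_(1 + n) := block_mx 1%:M 0 0 Q.
have BT : B^T = block_mx 1%:M 0 0 Q^T by rewrite tr_block_mx !trmx0 trmx1.
have B1 : B *m B^T = 1%:M.
  rewrite BT mulmx_block !(mulmx0, mul0mx) !(addr0, add0r) mulmx1 Q1.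
  by rewrite -scalar_mx_block.
exists (B *m H).
  by rewrite trmx_mul mulmxA -[B *m H *m _]mulmxA H1 mulmx1.
exists (row_mx a%:M d); rewrite trmx_mul.
have -> : B *m H *m X *m (H^T *m B^T) = B *m Y *m B^T by rewrite !mulmxA.
rewrite YE BT !mulmx_block !(mulmx0, mul0mx) !(addr0, add0r) mulmx1 mul1mx Qd.
have da : diag_mx (a%:M : 'rV[F]_1) = a%:M :> 'M[F]_1.
  by apply/matrixP => i j; rewrite !ord1 !mxE.
by rewrite !mul0mx -[in LHS]da -diag_mx_row.
Qed.

End Spectral.

(** * Rearrangement inequality for doubly stochastic matrices *)

Section Rearrangement.
Context {R : realDomainType}.
Variables theta lam : nat -> R.
Hypotheses (theta_homo : {homo theta : i j / (i <= j)%N >-> i <= j})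
  (lam_homo : {homo lam : i j / (i <= j)%N >-> j <= i}).

(* A discrete Legendre potential: with v l = theta l * lam l - u l it is
   an optimal dual solution of the assignment problem with costs
   theta j * lam l. *)
Lemma assignment_potential : exists u : nat -> R, forall j l,
  u j - u l <= (theta j - theta l) * lam l.
Proof.
pose u j := \sum_(0 <= i < j) (theta i.+1 - theta i) * lam i.+1.
(* The upper bound is the claim for j >= l; the lower bound is the claim for j < l with the two
   indices exchanged. *)
suff H l d : (theta (l + d)%N - theta l) * lam (l + d)%N <= u (l + d)%N - u l
    <= (theta (l + d)%N - theta l) * lam l.
  exists u => j l; case: (leqP l j) => [/subnKC <-|/ltnW/subnKC <-].
    by have /andP[] := H l (j - l)%N.
  by have /andP[+ _] := H j (l - j)%N; lra.
elim: d => [|d /andP[IH1 IH2]]; first by rewrite addn0 !subrr !mul0r lexx.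
have -> : u (l + d.+1)%N = u (l + d)%N +
    (theta (l + d.+1)%N - theta (l + d)%N) * lam (l + d.+1)%N.
  by rewrite addnS /u big_nat_recr.
have th1 := theta_homo (leq_addr d l).
have th2 : theta (l + d)%N <= theta (l + d.+1)%N.
  by apply: theta_homo; rewrite addnS.
have la1 : lam (l + d.+1)%N <= lam (l + d)%N by apply: lam_homo; rewrite addnS.
have la2 := lam_homo (leq_addr d.+1 l).
by apply/andP; split; nra.
Qed.

(** Weak duality: since rows and columns of [P] sum to 1, the left side is the [P]-weighted sum of
    u_i + (theta_j lam_j - u_j), and the potential bounds each such term by theta_i lam_j. *)
Lemma bistochastic_rearrangement k (P : 'M[R]_k) :
  (forall i j, 0 <= P i j) -> (forall i, \sum_j P i j = 1) ->
  (forall j, \sum_i P i j = 1) ->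
  \sum_(l < k) theta l * lam l <=
  \sum_(i < k) theta i * \sum_(j < k) P i j * lam j.
Proof.
move=> P0 Prow Pcol; have [u uP] := assignment_potential.
have -> : \sum_(l < k) theta l * lam l =
    \sum_(i < k) \sum_(j < k) P i j * (u i + (theta j * lam j - u j)).
  transitivity (\sum_(i < k) u i + \sum_(j < k) (theta j * lam j - u j)).
    by rewrite -big_split; apply: eq_bigr => i _ /=; rewrite addrCA subrr addr0.
  under [RHS]eq_bigr do under eq_bigr do rewrite mulrDr.
  under [RHS]eq_bigr do rewrite big_split.
  rewrite [RHS]big_split/=; congr (_ + _).
    by apply: eq_bigr => i _; rewrite -mulr_suml Prow mul1r.
  rewrite exchange_big; apply: eq_bigr => j _.
  by rewrite -mulr_suml Pcol mul1r.
apply: ler_sum => i _; rewrite mulr_sumr; apply: ler_sum => j _.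
rewrite mulrCA ler_wpM2l//; have := uP i j; lra.
Qed.

End Rearrangement.

(** * The function phi_t as an infimum over weights *)

Section Phi.
Context {R : realType}.
Variables (k t : nat) (lam : k.-tuple R).
Hypotheses (lam_sorted : sorted >=%R lam) (lam_ge0 : forall l, 0 <= lam`_l)
  (t_gt0 : (0 < t)%N) (t_le_k : (t <= k)%N).

Definition phi_dual (theta : nat -> R) : R :=
  \sum_(0 <= l < k) theta l * lam`_l - \sum_(0 <= l < t) (ln (theta l) + 1).

Lemma lam_homo : {homo nth 0 lam : i j / (i <= j)%N >-> j <= i}.
Proof.
move=> i j ij; have [jk|kj] := ltnP j k; last first.
  (* Past the end of the tuple the entry is the default 0, so monotonicity there is nonnegativity of
     [lam]. *)
  by rewrite (nth_default _ (_ : size lam <= j)%N) ?size_tuple.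
have ge_tr : transitive (>=%R : rel R) by move=> y x z xy /le_trans; apply.
have ge_refl : reflexive (>=%R : rel R) by move=> x; exact: lexx.
apply: (sorted_leq_nth ge_tr ge_refl 0 lam_sorted) => //;
  rewrite ?inE ?size_tuple//.
exact: leq_ltn_trans jk.
Qed.

Lemma iota_idxP : is_iota lam t (iota_idx lam t).
Proof. by apply: xgetPex; apply: is_iota_exists => // i _; exact: lam_ge0. Qed.

Let i := iota_idx lam t.
Let mu := tail_mean lam t i.

Let it : (i < t)%N. Proof. by case: iota_idxP. Qed.
Let ik : (i < k)%N. Proof. exact: leq_trans it _. Qed.
Let ti_gt0 : 0 < (t - i)%:R :> R. Proof. by rewrite ltr0n subn_gt0. Qed.
Let mu_ge0 : 0 <= mu.
Proof. by rewrite mulr_ge0 ?invr_ge0 ?ler0n// sumr_ge0. Qed.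
Let lam_le_mu l : (i <= l)%N -> lam`_l <= mu.
Proof.
by move=> /lam_homo/le_trans; apply; case: iota_idxP.
Qed.
Let mu_lt_lam l : (l < i)%N -> mu < lam`_l.
Proof.
move=> li; have [_ + _] := iota_idxP => /(_ (leq_ltn_trans (leq0n _) li)).
move=> /lt_le_trans; apply; apply: lam_homo.
by rewrite -ltnS prednK// (leq_ltn_trans _ li).
Qed.
Let lam_gt0 l : (l < i)%N -> 0 < lam`_l.
Proof. by move=> /mu_lt_lam; exact: le_lt_trans. Qed.
Let sum_tail : \sum_(i <= l < k) lam`_l = (t - i)%:R * mu.
Proof. by rewrite mulrA mulfV ?mul1r ?gt_eqF. Qed.

Let phi_pos : 0 < mu ->
  phi t lam = (\sum_(0 <= l < i) ln lam`_l + (t - i)%:R * ln mu)%:E.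
Proof.
move=> mu0; rewrite /phi -/i -/mu lne_EFin// EFinD EFinM; congr (_ + _)%E.
rewrite big_mkord -sumEFin; apply: eq_bigr => l _.
by rewrite lne_EFin ?lam_gt0.
Qed.

Let phi_mu0 : mu = 0 -> phi t lam = -oo%E.
Proof.
move=> mu0; rewrite /phi -/i -/mu mu0 le0_lneNy//.
by rewrite gt0_muleNy ?lte_fin// addeNy.
Qed.

Lemma ln_le_subr1 (x : R) : 0 < x -> ln x + 1 <= x.
Proof.
move=> x0; have := @le_ln1Dx R (x - 1).
by rewrite [1 + _]addrC subrK => /(_ _); lra.
Qed.

Lemma phi_le_dual (theta : nat -> R) : (forall l, 0 < theta l) ->
  {homo theta : i j / (i <= j)%N >-> i <= j} ->
  (phi t lam <= (phi_dual theta)%:E)%E.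
Proof.
move=> th0 th_homo.
have := mu_ge0; rewrite le_eqVlt => /predU1P[/esym/phi_mu0->|mu0].
  by rewrite leNye.
rewrite phi_pos// lee_fin.
have young (a x : R) : 0 < a -> 0 < x -> ln a + (ln x + 1) <= x * a.
  move=> a0 x0; have := ln_le_subr1 (mulr_gt0 x0 a0).
  by rewrite lnM ?posrE//; lra.
have head : \sum_(0 <= l < i) (ln lam`_l + (ln (theta l) + 1)) <=
    \sum_(0 <= l < i) theta l * lam`_l.
  by apply: ler_sum_nat => l /andP[_ li]; apply: young; rewrite ?lam_gt0.
have mid : \sum_(i <= l < t) (ln mu + (ln (theta l) + 1)) <=
    \sum_(i <= l < t) theta l * mu.
  by apply: ler_sum_nat => l _; exact: young.
(* Flattening the tail of [lam] to the value [mu] on [i, t) preserves its total and shifts mass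
   towards smaller weights. Comparing every weight with the pivot [theta t] gives the inequality:
   deviations are nonpositive before t and nonnegative after. *)
have tail : \sum_(i <= l < t) theta l * mu <=
    \sum_(i <= l < k) theta l * lam`_l.
  have h1 : \sum_(i <= l < t) theta t * (lam`_l - mu) <=
      \sum_(i <= l < t) theta l * (lam`_l - mu).
    apply: ler_sum_nat => l /andP[il lt].
    rewrite ler_wnM2r ?subr_le0 ?lam_le_mu//.
    exact/th_homo/ltnW.
  have h2 : \sum_(t <= l < k) theta t * lam`_l <=
      \sum_(t <= l < k) theta l * lam`_l.
    by apply: ler_sum_nat => l /andP[tl _]; rewrite ler_wpM2r ?th_homo.
  have h3 := sum_tail.
  rewrite (big_cat_nat (ltnW it) t_le_k)/= in h3.
  have {}h1 : theta t * (\sum_(i <= l < t) lam`_l - (t - i)%:R * mu) <=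
      \sum_(i <= l < t) theta l * lam`_l - \sum_(i <= l < t) theta l * mu.
    rewrite -sumrB [leRHS](eq_bigr _ (fun l _ => esym (mulrBr _ _ _))).
    by move: h1; rewrite -mulr_sumr sumrB sumr_const_nat -[mu *+ _]mulr_natl.
  rewrite -mulr_sumr in h2.
  have : theta t * (\sum_(i <= l < t) lam`_l - (t - i)%:R * mu) =
    - (theta t * \sum_(t <= l < k) lam`_l) by rewrite -h3; ring.
  by rewrite [leRHS](big_cat_nat (ltnW it) t_le_k)/=; lra.
rewrite /phi_dual (big_cat_nat (leq0n i) (ltnW ik))/=.
rewrite (big_cat_nat (leq0n i) (ltnW it))/=.
move: head mid; rewrite !big_split/= !sumr_const_nat !subn0.
by rewrite -[ln mu *+ _]mulr_natl; lra.
Qed.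

(** Weights for the reverse bound: eps = mu attains phi_t when mu > 0, and small [eps] drives the
    dual value to -oo when mu = 0. *)
Let cut (eps : R) l : R := if (l < i)%N then (lam`_l)^-1 else eps^-1.

Let cut_gt0 eps : 0 < eps -> forall l, 0 < cut eps l.
Proof.
by move=> e0 l; rewrite /cut; case: ifP => li; rewrite invr_gt0 ?lam_gt0.
Qed.

Let cut_homo eps : 0 < eps -> (forall l, (l < i)%N -> eps <= lam`_l) ->
  {homo cut eps : i j / (i <= j)%N >-> i <= j}.
Proof.
move=> e0 elam a b ab; rewrite /cut; case: ltnP => ai; case: ltnP => bi //.
- by rewrite lef_pV2 ?posrE ?lam_gt0// lam_homo.
- by rewrite lef_pV2 ?posrE ?lam_gt0// elam.
- by move: (leq_ltn_trans ab bi); rewrite ltnNge ai.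
Qed.

Let dual_cut eps : 0 < eps -> phi_dual (cut eps) =
  \sum_(0 <= l < i) ln lam`_l + (t - i)%:R * ln eps +
  (t - i)%:R * (eps^-1 * mu - 1).
Proof.
move=> e0; rewrite /phi_dual (big_cat_nat (leq0n i) (ltnW ik))/=.
rewrite [X in _ - X](big_cat_nat (leq0n i) (ltnW it))/=.
have -> : \sum_(0 <= l < i) cut eps l * lam`_l = \sum_(0 <= l < i) 1.
  apply: eq_big_nat => l /andP[_ li].
  by rewrite /cut li mulVf// gt_eqF ?lam_gt0.
have -> : \sum_(i <= l < k) cut eps l * lam`_l = eps^-1 * ((t - i)%:R * mu).
  rewrite -sum_tail mulr_sumr.
  by apply: eq_big_nat => l /andP[il _]; rewrite /cut ltnNge il.
have -> : \sum_(0 <= l < i) (ln (cut eps l) + 1) =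
    \sum_(0 <= l < i) (1 - ln lam`_l).
  apply: eq_big_nat => l /andP[_ li].
  by rewrite /cut li lnV ?posrE ?lam_gt0// addrC.
have -> : \sum_(i <= l < t) (ln (cut eps l) + 1) =
    \sum_(i <= l < t) (1 - ln eps).
  apply: eq_big_nat => l /andP[il _].
  by rewrite /cut ltnNge il/= lnV ?posrE// addrC.
rewrite sumrB [X in _ - (_ + X)]sumr_const_nat -[(1 - ln eps) *+ _]mulr_natl.
by ring.
Qed.

(** With [phi_le_dual] this identifies phi_t with the infimum of [phi_dual]; quantifying over lower
    bounds [a] also covers the value -oo. *)
Lemma phi_ge_dual (a : \bar R) :
  (forall theta : nat -> R, (forall l, 0 < theta l) ->
    {homo theta : i j / (i <= j)%N >-> i <= j} ->
    (a <= (phi_dual theta)%:E)%E) ->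
  (a <= phi t lam)%E.
Proof.
move=> aP.
have aE eps : 0 < eps -> (forall l, (l < i)%N -> eps <= lam`_l) ->
    (a <= (\sum_(0 <= l < i) ln lam`_l + (t - i)%:R * ln eps +
    (t - i)%:R * (eps^-1 * mu - 1))%:E)%E.
  move=> e0 elam; rewrite -dual_cut//.
  by apply: aP; [exact: cut_gt0|exact: cut_homo].
have := mu_ge0; rewrite le_eqVlt => /predU1P[/esym mu0|mu0]; last first.
  rewrite phi_pos//; have := aE mu mu0.
  rewrite mulVf ?gt_eqF// subrr mulr0 addr0.
  by apply => l /mu_lt_lam/ltW.
rewrite phi_mu0// leeNy_eq.
set C := \sum_(0 <= l < i) ln lam`_l in aE.
(* Any [eps] below [d] keeps [cut eps] nondecreasing. *)
have [d d0 dlam] : exists2 d : R, 0 < d & forall l, (l < i)%N -> d <= lam`_l.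
  case E : i => [|j]; first by exists 1.
  by exists lam`_j; [rewrite lam_gt0 ?E|move=> l lj; rewrite lam_homo].
case: a aP aE => [r| |] _ aE; last by [].
  (* [B] solves C + (t - i) B = r. For eps <= exp B the dual value is at most r - (t - i) < r, a
     contradiction. *)
  exfalso; set B := (r - C) / (t - i)%:R.
  have := aE (Num.min d (expR B)); rewrite mu0 mulr0 sub0r lee_fin.
  move=> /(_ _ _)/wrap[]; first by rewrite lt_min d0 expR_gt0.
    by move=> l /dlam; apply: le_trans; rewrite ge_min lexx.
  have : ln (Num.min d (expR B)) <= B.
    rewrite -[leRHS]expRK ler_ln ?posrE ?lt_min ?d0 ?expR_gt0//.
    by rewrite ge_min lexx orbT.
  by rewrite ler_pdivlMr//; have := ti_gt0; lra.
by have := aE d d0 dlam; rewrite leNgt ltry.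
Qed.

(** The nonnegative gaps mu - lam_l over [i, t) sum to 0, because the tail sum lives on [i, t). So
    [lam] equals [mu] there, and the averaged term is the log of a product of entries. *)
Lemma phi_rank : (forall l, (t <= l)%N -> lam`_l = 0) ->
  phi t lam = lne (\prod_(0 <= l < t) lam`_l)%:E.
Proof.
move=> lam0.
have lamE l : (i <= l < t)%N -> lam`_l = mu.
  have : \sum_(i <= l < t) (mu - lam`_l) = 0.
    rewrite sumrB sumr_const_nat -mulr_natl -sum_tail.
    have tail0 : \sum_(t <= j < k) lam`_j = 0.
      by rewrite big_nat_cond big1// => j /andP[/andP[/lam0]].
    by rewrite (big_cat_nat (ltnW it) t_le_k)/= tail0 addr0 subrr.
  rewrite big_nat_cond => /eqP; rewrite psumr_eq0; last first.
    by move=> j /andP[/andP[/lam_le_mu + _] _]; rewrite subr_ge0.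
  move=> /allP/(_ l) + ilt; rewrite mem_index_iota ilt => /(_ isT).
  by rewrite subr_eq0 eq_sym => /eqP.
have -> : \prod_(0 <= l < t) lam`_l = \prod_(0 <= l < i) lam`_l * mu ^+ (t - i).
  rewrite (big_cat_nat (leq0n i) (ltnW it))/=; congr (_ * _).
  by rewrite (eq_big_nat _ _ lamE) prodr_const_nat.
have := mu_ge0; rewrite le_eqVlt => /predU1P[/esym mu0|mu0].
  have mupow : mu ^+ (t - i) = 0 by rewrite mu0 expr0n gtn_eqF ?subn_gt0.
  by rewrite phi_mu0// mupow mulr0 le0_lneNy.
have P0 : 0 < \prod_(0 <= l < i) lam`_l.
  by rewrite big_nat_cond prodr_gt0// => l /andP[/andP[_ /lam_gt0]].
rewrite phi_pos// lne_EFin ?mulr_gt0 ?exprn_gt0// lnM ?posrE ?exprn_gt0//.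
rewrite lnXn// mulr_natl; congr (_ + _)%:E.
elim: (i) lam_gt0 => [|j IH] jgt0; first by rewrite !big_nil ln1.
rewrite !big_nat_recr//= lnM ?posrE ?jgt0// ?IH// => [l lj|].
  by rewrite jgt0// ltnW.
rewrite big_nat_cond prodr_gt0// => l /andP[/andP[_ lj] _].
by rewrite jgt0// ltnW.
Qed.

End Phi.

(** * Characteristic polynomials of products *)

(** Sylvester's identity: one block matrix is made block triangular by two different right factors,
    and the determinants are compared. *)
Lemma char_poly_mulmxC (K : comNzRingType) p q
    (M : 'M[K]_(p, q)) (N : 'M[K]_(q, p)) :
  'X^q * char_poly (M *m N) = 'X^p * char_poly (N *m M).
Proof.
rewrite /char_poly /char_poly_mx !map_mxM.
set B := map_mx _ M; set C := map_mx _ N.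
have E1 : block_mx 'X%:M B C 1%:M *m block_mx 1%:M 0 (- C) 1%:M =
    block_mx ('X%:M - B *m C) B 0 1%:M.
  rewrite mulmx_block !(mulmx1, mulmx0, mul1mx, mul0mx).
  by rewrite mulmxN add0r add0r subrr.
have E2 : block_mx 'X%:M B C 1%:M *m block_mx 1%:M (- B) 0 'X%:M =
    block_mx 'X%:M 0 C ('X%:M - C *m B).
  rewrite mulmx_block !(mulmx1, mulmx0, mul1mx, mul0mx) !mulmxN !addr0.
  by rewrite scalar_mxC addNr addrC.
have := congr1 determinant E1.
rewrite det_mulmx det_lblock det_ublock !det1 !mulr1.
have := congr1 determinant E2.
rewrite det_mulmx det_lblock det_ublock det1 mul1r.
by rewrite !det_scalar => + <- => <-; rewrite mulrC.
Qed.

Lemma char_poly_orthomx (K : idomainType) n (Q X : 'M[K]_n) : Q *m Q^T = 1%:M ->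
  char_poly (Q *m X *m Q^T) = char_poly X.
Proof.
move=> Q1; apply: (mulfI (monic_neq0 (monicXn _ n))).
by rewrite -mulmxA char_poly_mulmxC -mulmxA (mulmx1C Q1) mulmx1.
Qed.

(** * Concavity of Gamma_t on positive semidefinite matrices *)

Section GammaConcave.
Context {R : realType}.

(** Sorting the diagonal of an orthogonal diagonalization shows that [eigvals] is not the default
    value; the sorting permutation, as a matrix, is absorbed into [Q]. *)
Lemma symmx_eigvals n (X : 'M[R]_n) : X^T = X -> is_eigvals X (eigvals X) /\
  exists2 Q : 'M[R]_n, Q *m Q^T = 1%:M &
    Q *m X *m Q^T = diag_mx (\row_i (eigvals X)`_i).
Proof.
move=> Xsym; have [Q Q1 [d Qd]] := symmx_spectral Xsym.
pose l0 := [tuple d 0 i | i < n].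
have chX : char_poly X = \prod_(a <- l0) ('X - a%:P).
  rewrite -(char_poly_orthomx X Q1) Qd char_poly_trig ?diag_mx_is_trig//.
  by rewrite big_map big_enum; apply: eq_bigr => i _; rewrite mxE eqxx.
have ex : is_eigvals X [tuple of sort >=%R l0].
  split; first by apply: sort_sorted => x y; exact: le_total.
  by rewrite chX; apply/perm_big; rewrite perm_sym perm_sort.
have eX : is_eigvals X (eigvals X).
  by apply: xgetPex; exists [tuple of sort >=%R l0].
split=> //; have [p pE] : exists p : 'S_n,
    eigvals X = [tuple tnth l0 (p i) | i < n] :> seq R.
  apply/tuple_permP; rewrite (is_eigvals_unique eX ex).
  by rewrite perm_sort.
have dE (i : 'I_n) : (eigvals X)`_i = d 0 (p i).
  by rewrite pE -tnth_nth !tnth_mktuple.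
exists (perm_mx p *m Q).
  by rewrite trmx_mul mulmxA -[_ *m Q *m _]mulmxA Q1 mulmx1 tr_perm_mx -perm_mxM
    mulgV perm_mx1.
rewrite trmx_mul -!mulmxA [X in _ *m X]mulmxA [X in _ *m X]mulmxA Qd.
rewrite tr_perm_mx -col_permE -row_permE; apply/matrixP => i j; rewrite !mxE.
by rewrite (inj_eq perm_inj) dE.
Qed.

Lemma psdmx_eigvals_ge0 n (X : 'M[R]_n) l : psdmx X -> 0 <= (eigvals X)`_l.
Proof.
case=> Xsym Xpos; have [_ [Q _ QX]] := symmx_eigvals Xsym.
have [ln|nl] := ltnP l n; last by rewrite nth_default// size_tuple.
have := Xpos (row (Ordinal ln) Q)^T.
have -> : (row (Ordinal ln) Q)^T^T *m X *m (row (Ordinal ln) Q)^T =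
    row (Ordinal ln) (col (Ordinal ln) (Q *m X *m Q^T)).
  by rewrite trmxK tr_row !colE !rowE !mulmxA.
by rewrite QX !mxE eqxx.
Qed.

Lemma orthomx_diag_sum n (theta : nat -> R) (X Q : 'M[R]_n) :
  {homo theta : i j / (i <= j)%N >-> i <= j} -> psdmx X -> Q *m Q^T = 1%:M ->
  \sum_(0 <= l < n) theta l * (eigvals X)`_l <=
  \sum_(i < n) theta i * (Q *m X *m Q^T) i i.
Proof.
move=> th_homo Xpsd Q1; have [Xsym _] := Xpsd.
have [[Xsorted _] [S S1 SX]] := symmx_eigvals Xsym.
(* [B] is orthogonal, so its squared entries form a doubly stochastic matrix, which maps the
   eigenvalues to the diagonal of Q X Q^T. *)
pose B := Q *m S^T; pose P : 'M[R]_n := \matrix_(i, j) (B i j ^+ 2).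
have BT : B^T = S *m Q^T by rewrite trmx_mul trmxK.
have B1 : B *m B^T = 1%:M.
  by rewrite BT mulmxA -[_ *m S]mulmxA (mulmx1C S1) mulmx1.
have QXQ : Q *m X *m Q^T = B *m diag_mx (\row_i (eigvals X)`_i) *m B^T.
  rewrite -SX BT !mulmxA -[Q *m S^T *m S]mulmxA (mulmx1C S1) mulmx1.
  by rewrite -[_ *m S^T *m S]mulmxA (mulmx1C S1) mulmx1.
rewrite big_mkord.
have -> : \sum_(i < n) theta i * (Q *m X *m Q^T) i i =
    \sum_(i < n) theta i * \sum_(j < n) P i j * (eigvals X)`_j.
  apply: eq_bigr => i _; rewrite QXQ mul_mx_diag mxE; congr (_ * _).
  by apply: eq_bigr => j _; rewrite !mxE expr2 mulrAC.
apply: bistochastic_rearrangement => //.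
- by apply: lam_homo => // l; exact: psdmx_eigvals_ge0.
- by move=> i j; rewrite mxE sqr_ge0.
- move=> i; transitivity ((B *m B^T) i i); last by rewrite B1 mxE eqxx.
  by rewrite mxE; apply: eq_bigr => j _; rewrite !mxE expr2.
- move=> j; transitivity ((B^T *m B) j j); last first.
    by rewrite (mulmx1C B1) mxE eqxx.
  by rewrite mxE; apply: eq_bigr => i _; rewrite !mxE expr2.
Qed.

Lemma psdmx_convex n (X Y : 'M[R]_n) a : 0 <= a <= 1 -> psdmx X -> psdmx Y ->
  psdmx (a *: X + (1 - a) *: Y).
Proof.
move=> /andP[a0 a1] [Xsym Xpos] [Ysym Ypos]; split.
  by rewrite linearD/= !linearZ/= Xsym Ysym.
move=> v; rewrite mulmxDr mulmxDl -!scalemxAr -!scalemxAl !mxE.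
have := Xpos v; have := Ypos v; rewrite !mxE => yv xv.
by rewrite addr_ge0// mulr_ge0// subr_ge0.
Qed.

Section Concavity.
Variables (n t : nat).
Hypotheses (t_gt0 : (0 < t)%N) (t_le_n : (t <= n)%N).

Lemma Gamma_lty (X : 'M[R]_n) : psdmx X -> (Gamma t X < +oo)%E.
Proof.
move=> Xpsd; have [[Xsorted _] _] := symmx_eigvals Xpsd.1.
apply: (@le_lt_trans _ _ (phi_dual t (eigvals X) (fun=> 1))%:E);
  last exact: ltry.
by apply: phi_le_dual => // l; exact: psdmx_eigvals_ge0.
Qed.

Lemma Gamma_concave (X Y : 'M[R]_n) a : 0 <= a <= 1 -> psdmx X -> psdmx Y ->
  (a%:E * Gamma t X + (1 - a)%:E * Gamma t Y <=
   Gamma t (a *: X + (1 - a) *: Y)%R)%E.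
Proof.
move=> a01 Xpsd Ypsd; have Zpsd := psdmx_convex a01 Xpsd Ypsd.
set Z := a *: X + _ in Zpsd *.
have [[Zsorted _] [Q Q1 QZ]] := symmx_eigvals Zpsd.1.
have /andP[a0 a1] := a01.
apply: phi_ge_dual => // [l|theta th0 th_homo]; first exact: psdmx_eigvals_ge0.
(* The eigenbasis [Q] of [Z] stays fixed while [M] varies: [L] is affine, majorizes Gamma_t, and
   equals the dual value at [Z]. *)
pose L M := \sum_(i < n) theta i * (Q *m M *m Q^T) i i -
  \sum_(0 <= l < t) (ln (theta l) + 1).
have GL M : psdmx M -> (Gamma t M <= (L M)%:E)%E.
  move=> Mpsd; have [[Msorted _] _] := symmx_eigvals Mpsd.1.
  apply: (@le_trans _ _ (phi_dual t (eigvals M) theta)%:E).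
    by apply: phi_le_dual => // l; exact: psdmx_eigvals_ge0.
  by rewrite lee_fin lerD2r orthomx_diag_sum.
have -> : phi_dual t (eigvals Z) theta = a * L X + (1 - a) * L Y.
  have -> : phi_dual t (eigvals Z) theta = L Z.
    rewrite /phi_dual /L big_mkord QZ; congr (_ - _).
    by apply: eq_bigr => i _; rewrite !mxE eqxx.
  rewrite /L; have -> : \sum_(i < n) theta i * (Q *m Z *m Q^T) i i =
      a * (\sum_(i < n) theta i * (Q *m X *m Q^T) i i) +
      (1 - a) * (\sum_(i < n) theta i * (Q *m Y *m Q^T) i i).
    rewrite !mulr_sumr -big_split/=; apply: eq_bigr => i _.
    by rewrite /Z mulmxDr mulmxDl -!scalemxAr -!scalemxAl !mxE; ring.
  by ring.
rewrite [leRHS]EFinD [X in (_ <= X + _)%E]EFinM [X in (_ <= _ + X)%E]EFinM.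
by rewrite leeD// lee_wpmul2l ?lee_fin ?subr_ge0// GL.
Qed.

End Concavity.
End GammaConcave.

(** * Characteristic polynomials at 0/1 points *)

(** Again two triangularizations of one block matrix; idempotence of [D] makes the upper right block
    vanish in the second and gives the compressed form in the first. *)
Lemma char_poly_idem_complement (K : comNzRingType) n m
    (D : 'M[K]_n) (U : 'M[K]_(n, m)) :
  D *m D = D ->
  char_poly (D *m (1%:M - U *m U^T) *m D) * ('X - 1) ^+ m =
  char_poly D * char_poly (1%:M - U^T *m D *m U).
Proof.
move=> DD; rewrite /char_poly /char_poly_mx !(map_mxB, map_mxM, map_mx1)/=.
have : map_mx polyC D *m map_mx polyC D = map_mx polyC D by rewrite -map_mxM DD.
move: (map_mx polyC D) (map_mx polyC U) (map_mx polyC U^T) => E P T EE.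
have E1 : block_mx ('X%:M - E) (- (E *m P)) (T *m E) 1%:M *m
      block_mx 1%:M 0 (- (T *m E)) 1%:M =
    block_mx ('X%:M - E *m (1%:M - P *m T) *m E) (- (E *m P)) 0 1%:M.
  rewrite mulmx_block !(mulmx1, mulmx0, mul1mx, mul0mx, add0r, addr0) subrr.
  congr block_mx; rewrite mulmxN mulNmx opprK mulmxBr mulmx1 mulmxBl EE.
  by rewrite opprB !mulmxA addrA addrAC.
have E2 : block_mx ('X%:M - E) (- (E *m P)) (T *m E) 1%:M *m
      block_mx 1%:M (E *m P) 0 ('X - 1)%:M =
    block_mx ('X%:M - E) 0 (T *m E) ('X%:M - (1%:M - T *m E *m P)).
  rewrite mulmx_block !(mulmx1, mulmx0, mul1mx, mul0mx, add0r, addr0).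
  congr block_mx.
    rewrite addrC mulmxBl [E *m (E *m P)]mulmxA EE mul_scalar_mx mul_mx_scalar.
    rewrite scalerBl scale1r.
    by rewrite scalerN opprK addrACA addNr subrr addr0.
  by rewrite !mulmxA -[T *m E *m E]mulmxA EE raddfB/= opprB addrCA addrC.
have := congr1 determinant E1.
rewrite det_mulmx det_lblock det_ublock !det1 !mulr1.
have := congr1 determinant E2.
rewrite det_mulmx det_lblock det_ublock det1 mul1r.
by rewrite det_scalar => + <- => ->.
Qed.

Section ZeroOne.
Context {R : realType}.

Lemma sum_ones n (x : 'cV[R]_n) : ((ones n)^T *m x) 0 0 = \sum_i x i 0.
Proof. by rewrite mxE; apply: eq_bigr => i _; rewrite !mxE mul1r. Qed.

Lemma Diag_ones n : Diag (ones n : 'cV[R]_n) = 1%:M.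
Proof. by rewrite /Diag /ones trmx_const diag_const_mx. Qed.

Lemma DiagB n (x y : 'cV[R]_n) : Diag (x - y) = Diag x - Diag y.
Proof. by rewrite /Diag !linearB. Qed.

Lemma Diag_idem n (x : 'cV[R]_n) : (forall i, x i 0 = 0 \/ x i 0 = 1) ->
  Diag x *m Diag x = Diag x.
Proof.
move=> x01; apply/matrixP => i j; rewrite /Diag mul_diag_mx !mxE.
by case: eqP => [->|]; [case: (x01 j) => ->|];
  rewrite ?mulr0n ?mulr0 ?mulr1n ?mulr1.
Qed.

Lemma char_poly_Diag01 n (x : 'cV[R]_n) t :
  (forall i, x i 0 = 0 \/ x i 0 = 1) ->
  \sum_i x i 0 = t%:R -> char_poly (Diag x) = ('X - 1) ^+ t * 'X^(n - t).
Proof.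
move=> x01 xt; have tE : #|[pred i | x i 0 == 1]| = t.
  apply/eqP; rewrite -(eqr_nat R) -xt -sum1_card natr_sum big_mkcond/=.
  apply/eqP/eq_bigr => i _; rewrite inE.
  by case: (x01 i) => ->; rewrite ?eqxx// eq_sym oner_eq0.
rewrite char_poly_trig ?diag_mx_is_trig//.
rewrite (bigID [pred i | x i 0 == 1])/=; congr (_ * _).
  rewrite -tE -prodr_const; apply: eq_bigr => i /eqP xi.
  by rewrite !mxE eqxx xi.
have -> : (n - t)%N = #|[predC [pred i | x i 0 == 1]]|.
  by rewrite -[X in (X - t)%N]card_ord -(cardC [pred i | x i 0 == 1]) tE addKn.
rewrite -prodr_const.
apply: eq_big => [i|i]; first by rewrite !inE.
by rewrite !mxE eqxx; case: (x01 i) => ->; rewrite ?eqxx// subr0.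
Qed.

(** The factor ('X - 1)^m does not vanish at 0, so all [d] zero roots come from [l]; being
    nonnegative and sorted, [l] has its zeros at the end. *)
Lemma tail_roots_eq0 k (l : k.-tuple R) d m (G : {poly R}) :
  sorted >=%R l -> (forall i, 0 <= l`_i) ->
  (\prod_(a <- l) ('X - a%:P)) * ('X - 1) ^+ m = 'X^d * G ->
  (d <= k)%N /\ forall i, (k - d <= i)%N -> l`_i = 0.
Proof.
move=> l_sorted l0 PG.
set c := count (pred1 0) l.
have dc : (d <= c)%N.
  rewrite leqNgt; apply/negP => cd.
  have zeros : \prod_(a <- l | pred1 0 a) ('X - a%:P) = 'X^c.
    rewrite (eq_bigr (fun=> 'X)) => [|a /eqP ->]; last by rewrite subr0.
    by rewrite big_const_seq iter_mulr_1.
  move: PG; rewrite (bigID (pred1 0)) zeros/=.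
  rewrite -(subnKC (ltnW cd)) exprD -!mulrA.
  move/(mulfI (monic_neq0 (monicXn _ _)))/(congr1 (horner^~ 0)).
  rewrite !hornerE -subnSK//= expr0n/= mul0r => /eqP.
  rewrite mulf_eq0 horner_prod.
  rewrite prodf_seq_eq0 expf_eq0 oppr_eq0 oner_eq0 andbF orbF.
  move=> /hasP[a _ /andP[a0]]; rewrite !hornerE oppr_eq0.
  by rewrite (negPf a0).
have ck : (c <= k)%N by rewrite -(size_tuple l) count_size.
split; first exact: leq_trans ck.
move=> i kdi; apply/eqP/negP => /negP li.
have ik : (i < k)%N.
  by rewrite ltnNge; apply: contra li => ki; rewrite nth_default ?size_tuple.
(* A positive entry at [i] makes the first i + 1 entries positive, leaving room for fewer than [d]
   zeros. *)
have : (c <= k - i.+1)%N.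
  rewrite /c -(cat_take_drop i.+1 l) count_cat.
  have -> : count (pred1 0) (take i.+1 l) = 0%N.
    apply/eqP; rewrite -leqn0 leqNgt -has_count; apply/hasPn => a.
    move=> /(nthP 0)[j]; rewrite size_take size_tuple.
    move=> jlt; have {}jlt : (j < i.+1)%N by move: jlt; case: ifP => // *; lia.
    rewrite nth_take// => <-; rewrite /= gt_eqF//.
    apply: lt_le_trans (lam_homo l_sorted l0 (_ : j <= i)%N) => //.
    by rewrite lt_def li l0.
  by rewrite add0n (leq_trans (count_size _ _))// size_drop size_tuple.
by lia.
Qed.

End ZeroOne.

(** * Exactness and convexity of the relaxation *)

Section Relaxation.
Context {R : realType}.

Lemma convex_set_segments (E : lmodType R) (A : set E) :
  (forall (a : R) x y, 0 <= a <= 1 -> A x -> A y ->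
    A (a *: x + (1 - a) *: y)) ->
  @convex_set R E A.
Proof.
move=> HA x y l /set_mem xA /set_mem yA; apply/mem_set.
apply: (HA l%:num x y _ xA yA); rewrite ge0/=; exact: le1.
Qed.

Lemma psdmx_compression n k (W : 'M[R]_(n, k)) (y : 'cV[R]_n) :
  (forall i, 0 <= y i 0) -> psdmx (W^T *m Diag y *m W).
Proof.
move=> y0; split; first by rewrite !trmx_mul trmxK tr_diag_mx mulmxA.
move=> v; rewrite !mulmxA -mulmxA -[v^T *m W^T]trmx_mul.
rewrite mul_mx_diag mxE sumr_ge0// => i _; rewrite !mxE mulrAC.
by rewrite mulr_ge0// -expr2 sqr_ge0.
Qed.

Lemma sum_complement n (x : 'cV[R]_n) a : ((ones n)^T *m x) 0 0 = a ->
  \sum_i (ones n - x) i 0 = n%:R - a.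
Proof.
move=> xa; rewrite (eq_bigr (fun i => 1 - x i 0)) => [|i _].
  by rewrite sumrB -sum_ones xa sumr_const card_ord.
by rewrite !mxE.
Qed.

Lemma Gamma_compression01 n m s (U : 'M[R]_(n, m)) (W : 'M[R]_(n, n - m))
    (x : 'cV[R]_n) :
  (m <= s)%N -> (s < n)%N -> U^T *m U = 1%:M -> 1%:M - U *m U^T = W *m W^T ->
  dopt_feasible s x ->
  let d := \det (U^T *m Diag x *m U) in
  0 <= d /\ Gamma (n - s) (W^T *m Diag (ones n - x) *m W) = lne d%:E.
Proof.
move=> ms sn U1 UW [xs x01] d.
set D := Diag (ones n - x); set X := W^T *m D *m W.
pose t := (n - s)%N; pose k := (n - m)%N.
have t0 : (0 < t)%N by rewrite subn_gt0.
have tk : (t <= k)%N by rewrite leq_sub2l.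
have y01 i : (ones n - x) i 0 = 0 \/ (ones n - x) i 0 = 1.
  rewrite !mxE.
  by case: (x01 i) => ->; [right; rewrite subr0|left; rewrite subrr].
have ysum : \sum_i (ones n - x) i 0 = t%:R.
  by rewrite (sum_complement xs) natrB// ltnW.
have Xpsd : psdmx X.
  by apply: psdmx_compression => i; case: (y01 i) => ->.
have [[Xsorted charX] _] := symmx_eigvals Xpsd.1.
set l := eigvals X in Xsorted charX.
have l0 i : 0 <= l`_i by exact: psdmx_eigvals_ge0.
have DD : D *m D = D by exact: Diag_idem.
have dE : 1%:M - U^T *m D *m U = U^T *m Diag x *m U.
  by rewrite /D DiagB Diag_ones mulmxBr mulmxBl mulmx1 U1 subKr.
have PE : char_poly X * ('X - 1) ^+ m =
    'X^(s - m) * (('X - 1) ^+ t * char_poly (U^T *m Diag x *m U)).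
  (* The factor 'X^n allows rotating (W^T D)(D W) into D W W^T D = D (1 - U U^T) D. The powers of 'X
     then match because (n - m) + s = n + (s - m). *)
  apply: (mulfI (monic_neq0 (monicXn _ n))).
  have -> : X = (W^T *m D) *m (D *m W).
    by rewrite mulmxA -[_ *m D *m D]mulmxA DD.
  rewrite [LHS]mulrA char_poly_mulmxC mulmxA -[D *m W *m W^T]mulmxA -UW -mulrA.
  rewrite char_poly_idem_complement// dE (char_poly_Diag01 y01 ysum).
  rewrite subKn ?(ltnW sn)// [('X - 1) ^+ t * _]mulrC !mulrA -!exprD.
  by congr ('X^ _ * _ * _); lia.
have [_ tail] : (s - m <= k)%N /\
    forall i, (k - (s - m) <= i)%N -> l`_i = 0.
  by apply: tail_roots_eq0 Xsorted l0 _; rewrite -charX; exact: PE.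
have ktE : (k - (s - m) = t)%N by rewrite /k /t; lia.
rewrite ktE in tail.
(* Cancel 'X^(s - m) and evaluate at 0: both sides carry the same signs (-1)^t and (-1)^m. *)
have prodE : \prod_(0 <= i < t) l`_i = d.
  move: PE; rewrite charX (big_nth 0) size_tuple (big_cat_nat (leq0n t) tk)/=.
  have -> : \prod_(t <= i < k) ('X - (l`_i)%:P) = 'X^(s - m).
    rewrite (eq_big_nat _ _ (F2 := fun=> 'X)) => [|i /andP[ti _]].
      by rewrite prodr_const_nat; congr ('X^_); rewrite /k /t; lia.
    by rewrite tail// subr0.
  rewrite [_ * 'X^_]mulrC -mulrA => /(mulfI (monic_neq0 (monicXn _ _))).
  move/(congr1 (horner^~ 0)).
  rewrite !hornerE [X in _ = _ * X]horner_coef0 char_poly_det.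
  rewrite horner_prod (eq_bigr (fun i => -1 * l`_i)) => [|i _]; last first.
    by rewrite !hornerE mulN1r.
  rewrite big_split/= prodr_const_nat subn0 -/d.
  have sgn j : (-1) ^+ j != 0 :> R by rewrite signr_eq0.
  by rewrite -mulrA => /(mulfI (sgn t)); rewrite mulrC => /(mulfI (sgn m)).
split; first by rewrite -prodE prodr_ge0.
by rewrite /Gamma phi_rank// prodE.
Qed.

(** Full column rank of [A] passes to [Sg], whose determinant is thus nonzero. This makes the
    constant in the relaxed objective finite. *)
Lemma compact_svd_diag_gt0 n m (A U : 'M[R]_(n, m)) (Sg V : 'M[R]_m) :
  \rank A = m -> compact_svd A U Sg V -> forall i, 0 < Sg i i.
Proof.
move=> rA [AE _ _ /diag_mxP[d SgE] Sg0] i; rewrite lt_def Sg0 andbT.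
have rS : \rank Sg = m.
  apply/eqP; rewrite eqn_leq rank_leq_row -{1}rA AE.
  by rewrite (leq_trans (mxrankM_maxl _ _))// mxrankM_maxr.
have : \det Sg != 0 by rewrite -unitfE -unitmxE -row_full_unit /row_full rS.
rewrite {1}SgE det_diag => /prodf_neq0/(_ i isT).
by rewrite SgE mxE eqxx.
Qed.

End Relaxation.

Theorem theorem7 (R : realType) (n m s : nat) (A U : 'M[R]_(n, m))
    (Sg V : 'M[R]_m) (W : 'M[R]_(n, n - m)) :
  \rank A = m -> (m <= s)%N -> (s < n)%N ->
  compact_svd A U Sg V ->
  1%:M - U *m U^T = W *m W^T ->
  (forall x : 'cV[R]_n, dopt_feasible s x ->
     relax_feasible s (ones n - x) /\
     relax_objective s Sg W (ones n - x) = dopt_objective A x) /\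
  [/\ relax_feasible s `<=` relax_domain W,
      convex_set (relax_feasible s : set 'cV[R]_n) &
      concave_on (relax_domain W) (relax_objective s Sg W)].
Proof.
move=> rA ms sn svd UW; have Sg_gt0 := compact_svd_diag_gt0 rA svd.
have [AE U1 [V1 V2] Sgdiag _] := svd.
pose c := \sum_(i < m) ln (Sg i i).
have cE : (2%:E * \sum_(i < m) lne (Sg i i)%:E)%E = (2 * c)%:E.
  rewrite EFinM; congr (_ * _)%E; rewrite -sumEFin; apply: eq_bigr => i _.
  by rewrite lne_EFin.
have t0 : (0 < n - s)%N by rewrite subn_gt0.
have tk : (n - s <= n - m)%N by rewrite leq_sub2l.
split.
  move=> x xfeas; have [xs x01] := xfeas; split.
    split=> [|i]; last first.
      by rewrite !mxE; case: (x01 i) => ->; rewrite ?subr0 ?subrr ?lexx ler01.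
    by rewrite sum_ones (sum_complement xs) natrB// ltnW.
  rewrite /relax_objective cE.
  have [d0 ->] := Gamma_compression01 ms sn U1 UW xfeas.
  set d := \det _ in d0 *.
  have Sgdet : \det Sg = \prod_i Sg i i.
    have /diag_mxP[e SgE] := Sgdiag.
    by rewrite SgE det_diag; apply: eq_bigr => i _; rewrite mxE eqxx.
  have P0 : 0 < \det Sg by rewrite Sgdet prodr_gt0.
  have lnP : ln (\det Sg) = c.
    rewrite Sgdet /c.
    (* Positivity of the partial products is carried along, as [lnM] requires it. *)
    suff [] : 0 < \prod_i Sg i i /\
      ln (\prod_i Sg i i) = \sum_i ln (Sg i i) by [].
    elim/big_rec2: _ => [|i y z _ [z0 <-]]; first by rewrite ln1.
    by rewrite mulr_gt0// lnM ?posrE.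
  have detE : \det (A^T *m Diag x *m A) = \det Sg ^+ 2 * d.
    have -> : A^T *m Diag x *m A =
        V *m (Sg^T *m (U^T *m Diag x *m U) *m Sg) *m V^T.
      by rewrite AE !trmx_mul trmxK !mulmxA.
    have VV : \det V * \det V = 1 by rewrite -{2}det_tr -det_mulmx V2 det1.
    rewrite [LHS]det_mulmx det_mulmx [X in _ * X * _]det_mulmx.
    rewrite [X in _ * (X * _) * _]det_mulmx !det_tr -/d.
    by rewrite -[RHS]mul1r -VV; ring.
  rewrite /dopt_objective /ldet detE.
  (* If d = 0, both objectives are -oo. *)
  move: d0; rewrite le_eqVlt => /predU1P[<-|d0].
    by rewrite mulr0 !le0_lneNy// addeNy.
  rewrite !lne_EFin ?mulr_gt0 ?exprn_gt0// lnM ?posrE ?exprn_gt0// lnXn// lnP.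
  by rewrite -EFinD mulr_natl.
split.
- move=> y [_ y01]; apply: psdmx_compression => i.
  by case/andP: (y01 i).
- apply: convex_set_segments => a x y /andP[a0 a1] [xs x01] [ys y01]; split.
    rewrite sum_ones (eq_bigr (fun i => a * x i 0 + (1 - a) * y i 0)) => [|i _].
      rewrite big_split/= -!mulr_sumr -!sum_ones xs ys.
      by rewrite -mulrDl addrC subrK mul1r.
    by rewrite !mxE.
  move=> i; rewrite !mxE.
  have /andP[x0 x1] := x01 i; have /andP[y0 y1] := y01 i.
  by apply/andP; split; nra.
(* The objective is a finite constant plus Gamma composed with a linear map, so concavity is
   inherited. *)
have lin (a : R) x y : W^T *m Diag (a *: x + (1 - a) *: y) *m W =
    a *: (W^T *m Diag x *m W) + (1 - a) *: (W^T *m Diag y *m W).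
  have -> : Diag (a *: x + (1 - a) *: y) = a *: Diag x + (1 - a) *: Diag y.
    by rewrite /Diag !linearD/= !linearZ.
  rewrite mulmxDr mulmxDl.
  by rewrite -!scalemxAr -!scalemxAl.
split.
- apply: convex_set_segments => a x y a01 xd yd.
  by rewrite /relax_domain/= lin; exact: psdmx_convex.
- move=> x xd; rewrite /relax_objective cE lte_add_pinfty ?ltry//.
  exact: Gamma_lty.
move=> a x y a01 xd yd; rewrite /relax_objective cE lin.
have /andP[a0 a1] := a01.
apply: le_trans (leeD2l (2 * c)%:E (Gamma_concave t0 tk a01 xd yd)).
move: (Gamma _ _) (Gamma _ _) => gx gy.
rewrite !muleDr ?fin_num_adde_defr//.
by rewrite addeACA -!EFinM -EFinD -mulrDl [a + _]addrC subrK mul1r.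
Qed.
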